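(* Let $K$ be a field of characteristic zero, let $n$ be a positive integer, and let $A=M_n(K)$ be endowed with the Vasilovsky $\mathbb{Z}_n$-grading. Let $f(x_1,\dots,x_m)\in K\langle X|\mathbb{Z}_n\rangle$ be a graded polynomial of homogeneous $\mathbb{Z}_n$-degree $g\neq 0$. If $f$ is not a graded polynomial identity of $A$, then the linear span over $K$ of $Im(f)$ (the image of $f$ on $A$) equals the homogeneous component $A_g$.
   Context: Vasilovsky (canonical) $\mathbb{Z}_n$-grading on $A=M_n(K)$: $A=\bigoplus_{g\in\mathbb{Z}_n}A_g$, where $A_g$ is the $K$-span of the matrix units $E_{i,j}$ with $j-i\equiv g \pmod n$ (indices of matrix units are read modulo $n$). Graded polynomials: $X=\bigcup_{g\in \mathbb{Z}_n}X_g$ is a disjoint union of countable sets of noncommuting variables, and $K\langle X|\mathbb{Z}_n\rangle$ is the free associative unital $K$-algebra on $X$. A variable $x\in X_g$ has $\mathbb{Z}_n$-degree $\deg(x)=g$, and $\deg(x_{i_1}\cdots x_{i_k})=\deg(x_{i_1})+\cdots+\deg(x_{i_k})$. Elements of this algebra are graded polynomials; a graded polynomial is homogeneous of $\mathbb{Z}_n$-degree $g$ if it is a linear combination of monomials of $\mathbb{Z}_n$-degree $g$. Image: if $g_i=\deg(x_i)$, the image $Im(f)$ of $f(x_1,\dots,x_m)$ on $A$ is $\{f(a_1,\dots,a_m) : a_i\in A_{g_i},\ i=1,\dots,m\}$. The polynomial $f$ is a graded polynomial identity of $A$ if $Im(f)=\{0\}$. *)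

(* Defs.v *)
From mathcomp Require Import all_boot all_algebra.
From mathcomp Require Import finmap monalg.

Set Implicit Arguments.
Unset Strict Implicit.
Unset Printing Implicit Defensive.

Import GRing.Theory.

Local Open Scope ring_scope.

(* The cyclic group of order n.+1 is ['I_n.+1] with its canonical zmodType
   structure, in which [j - i] is computed modulo n.+1; the matrix size n.+1
   ranges over all positive integers, 1 included (['Z_1] would be Z/2). *)

(* (g, k) is the k-th variable of degree g. *)
Notation variable n := ('I_n.+1 * nat)%type.

Definition var_deg (n : nat) (y : variable n) : 'I_n.+1 := y.1.

(* The free associative unital algebra is the monoid algebra of the free
   monoid of words in the variables. *)
Notation graded_poly K n := {malg K[{fmonom variable n}]}.

Definition mon_deg (n : nat) (w : {fmonom variable n}) : 'I_n.+1 :=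
  \sum_(y <- w) var_deg y.

Definition homogeneous (K : fieldType) (n : nat)
    (f : graded_poly K n) (g : 'I_n.+1) : Prop :=
  {in msupp f, forall w, mon_deg w = g}.

Definition poly_in (K : fieldType) (n m : nat)
    (f : graded_poly K n) (x : m.-tuple (variable n)) : Prop :=
  forall w : {fmonom variable n},
    w \in msupp f -> {subset (w : seq (variable n)) <= x}.

Definition vasilovsky (K : fieldType) (n : nat) (g : 'I_n.+1) :
    {vspace 'M[K]_n.+1} :=
  <<[seq delta_mx ij.1 ij.2 |
      ij : 'I_n.+1 * 'I_n.+1 in [pred ij | ij.2 - ij.1 == g]]>>%VS.

(* f(a_1, ..., a_m): the variable x_i is replaced by a_i. Variables outside x
   are sent to 0, which is irrelevant when [poly_in f x]. *)
Definition peval (K : fieldType) (n m : nat) (x : m.-tuple (variable n))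
    (a : m.-tuple 'M[K]_n.+1) (f : graded_poly K n) : 'M[K]_n.+1 :=
  mmap (@scalar_mx K n.+1)
    (fun w : {fmonom variable n} => \prod_(y <- w) nth 0 a (index y x)) f.

Definition graded_image (K : fieldType) (n m : nat) (x : m.-tuple (variable n))
    (f : graded_poly K n) (b : 'M[K]_n.+1) : Prop :=
  exists2 a : m.-tuple 'M[K]_n.+1,
    forall i, tnth a i \in vasilovsky K (var_deg (tnth x i))
  & b = peval x a f.

Definition graded_identity (K : fieldType) (n m : nat)
    (x : m.-tuple (variable n)) (f : graded_poly K n) : Prop :=
  forall b, graded_image x f b <-> b = 0.

Definition lin_span (K : fieldType) (V : vectType K) (S : V -> Prop)
    (v : V) : Prop :=
  exists2 s : seq V, (forall u, u \in s -> S u) & v \in <<s>>%VS.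

(* Main.v *)
Require Import Defs.
From mathcomp Require Import all_boot all_algebra.
From mathcomp Require Import finmap monalg.
From mathcomp Require Import perm ring.
From Stdlib Require Import Classical.

Set Implicit Arguments.
Unset Strict Implicit.
Unset Printing Implicit Defensive.

Import GRing.Theory.

Local Open Scope ring_scope.

(** The image of [f] is stable under every conjugation that preserves the
    grading ([graded_image_conj]), and two families of these are enough.

    - A diagonal matrix [d] multiplies the entry at [(i, i + g)] by
      [d_i / d_(i + g)].  Take [d] with the entry 2 at [j] and 1 elsewhere.  As
      [g != 0], the matrix unit at [(j, j + g)] is scaled by 2, the one at
      [(j - g, j)] by 1/2, and all others of degree [g] are fixed.  Conjugation
      [T] by [d] is therefore diagonalizable on the component of degree [g],
      with a one-dimensional eigenspace for 2, and the polynomial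
      [(T - 1)(T - 1/2)] extracts from [b] a multiple of this matrix unit,
      nonzero as soon as [b j (j + g)] is ([lin_span_graded_image_delta]).

    - Conjugation by a cyclic permutation matrix moves a nonzero entry of degree
      [g] to any other position of degree [g].

    So one nonzero value of [f] puts all matrix units of degree [g] in the span
    of the image.  The reverse inclusion holds because the values of [f] are
    homogeneous of degree [g] ([graded_image_vasilovsky]). *)

Section LinSpan.

Variables (K : fieldType) (V : vectType K) (S : V -> Prop).

Lemma lin_span_incl v : S v -> lin_span S v.
Proof.
move=> Sv; exists [:: v]; last by rewrite memv_span ?mem_head.
by move=> u; rewrite inE => /eqP->.
Qed.

Lemma lin_span0 : lin_span S 0.
Proof. by exists [::]; rewrite ?mem0v. Qed.

Lemma lin_spanD u v : lin_span S u -> lin_span S v -> lin_span S (u + v).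
Proof.
move=> [s Ss su] [t St tv]; exists (s ++ t); last by rewrite span_cat memv_add.
by move=> w; rewrite mem_cat => /orP[/Ss | /St].
Qed.

Lemma lin_spanZ c v : lin_span S v -> lin_span S (c *: v).
Proof. by move=> [s Ss sv]; exists s; rewrite ?memvZ. Qed.

Lemma lin_span_sub (U : {vspace V}) v :
  (forall u, S u -> u \in U) -> lin_span S v -> v \in U.
Proof. by move=> SU [s Ss]; apply/subvP/span_subvP => u /Ss/SU. Qed.

End LinSpan.

Section Grading.

Variables (K : fieldType) (n : nat).
Implicit Types (a b u v : 'M[K]_n.+1) (g h : 'I_n.+1).

Lemma vasilovsky_sum_delta g b :
    (forall i j, j - i != g -> b i j = 0) ->
  b = \sum_i b i (i + g) *: delta_mx i (i + g).
Proof.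
move=> b0; rewrite {1}[b]matrix_sum_delta; apply: eq_bigr => i _.
rewrite (bigD1 (i + g)) //= big1 ?addr0 // => j ne_j.
by rewrite b0 ?scale0r // subr_eq addrC.
Qed.

Lemma vasilovskyP g b :
  reflect (forall i j, j - i != g -> b i j = 0) (b \in vasilovsky K g).
Proof.
apply: (iffP idP) => [/coord_span-> i j ne_g | /vasilovsky_sum_delta->].
  rewrite summxE big1 // => k _; rewrite mxE.
  set e := image_tuple _ _; have : e`_k \in e by rewrite mem_nth ?size_tuple.
  case/imageP=> [[i' j'] /= /eqP def_g ->].
  rewrite mxE; case: eqP => [def_i|_]; case: eqP => [def_j|_];
    rewrite ?mulr0 //.
  by rewrite def_i def_j def_g eqxx in ne_g.
apply: rpred_sum => i _; apply/memvZ/memv_span/imageP.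
by exists (i, i + g) => //=; rewrite inE /= addrC addKr.
Qed.

Lemma vasilovsky1 : 1 \in vasilovsky K (0 : 'I_n.+1).
Proof.
apply/vasilovskyP => i j; rewrite subr_eq0 eq_sym => /negPf ne_ij.
by rewrite !mxE ne_ij.
Qed.

Lemma vasilovskyM g h a b :
  a \in vasilovsky K g -> b \in vasilovsky K h ->
  a * b \in vasilovsky K (g + h).
Proof.
move=> /vasilovskyP a0 /vasilovskyP b0; apply/vasilovskyP => i j ne_gh.
rewrite mxE big1 // => k _.
have [def_g | /a0->] := eqVneq (k - i) g; last by rewrite mul0r.
rewrite b0 ?mulr0 //; apply: contra ne_gh => /eqP <-.
by rewrite -def_g [eqbRHS]addrC addrA subrK.
Qed.

End Grading.

Section GradedImage.

Variables (K : fieldType) (n m : nat) (x : m.-tuple (variable n)).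
Variable f : graded_poly K n.
Implicit Types (a : m.-tuple 'M[K]_n.+1) (b u v : 'M[K]_n.+1).

Lemma graded_image_vasilovsky g b :
  homogeneous f g -> graded_image x f b -> b \in vasilovsky K g.
Proof.
move=> f_homog [a a_deg ->]; rewrite /peval mmapE.
rewrite big_seq; apply: rpred_sum => w /f_homog <-.
rewrite -mulmxE mul_scalar_mx memvZ //.
rewrite /mon_deg; apply: (big_ind2 (fun c h => c \in vasilovsky K h)).
- exact: vasilovsky1.
- by move=> ? ? ? ?; apply: vasilovskyM.
move=> y _; have [x_y | x'y] := boolP (y \in x).
  have lt_y: (index y x < m)%N by rewrite -index_mem size_tuple in x_y.
  have := a_deg (Ordinal lt_y).
  by rewrite (tnth_nth 0) (tnth_nth y) /= nth_index.
(* A variable outside x is evaluated at 0, which has every degree. *)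
by rewrite nth_default ?mem0v // memNindex // !size_tuple.
Qed.

Lemma peval_conj a u v : v * u = 1 -> u * v = 1 ->
  peval x (map_tuple (fun c => u * c * v) a) f = u * peval x a f * v.
Proof.
move=> vu uv; rewrite /peval !mmapE mulr_sumr mulr_suml.
apply: eq_bigr => w _; rewrite -!mulmxE !mul_scalar_mx !mulmxE.
rewrite -scalerAr -scalerAl; congr (_ *: _).
have conjM : {morph (fun c => u * c * v) : c d / c * d}.
  by move=> c d /=; rewrite !mulrA -[_ * v * u]mulrA vu mulr1.
have conj1 : u * 1 * v = 1 by rewrite mulr1.
rewrite (big_morph _ conjM conj1); apply: eq_bigr => y _.
have [lt_a | ge_a] := ltnP (index y x) (size a).
  by rewrite (nth_map 0).
by rewrite !nth_default ?size_map // mulr0 mul0r.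
Qed.

(** Evaluation commutes with conjugation ([peval_conj]), and stability of
    the grading means that the conjugate tuple may again be substituted. *)
Lemma graded_image_conj u v b : v * u = 1 -> u * v = 1 ->
    (forall h c, c \in vasilovsky K h -> u * c * v \in vasilovsky K h) ->
  graded_image x f b -> graded_image x f (u * b * v).
Proof.
move=> vu uv graded [a a_deg ->].
exists (map_tuple (fun c => u * c * v) a); last by rewrite peval_conj.
by move=> i; rewrite tnth_map graded.
Qed.

Lemma graded_image_diag (d : 'rV[K]_n.+1) b : (forall i, d 0 i != 0) ->
    graded_image x f b ->
  graded_image x f (\matrix_(i, j) (d 0 i * b i j / d 0 j)).
Proof.
move=> d_neq0 Sb; pose e : 'rV_n.+1 := \row_i (d 0 i)^-1.
have conjE c :
    diag_mx d * c * diag_mx e = \matrix_(i, j) (d 0 i * c i j / d 0 j).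
  by apply/matrixP=> i j; rewrite -!mulmxE mul_diag_mx mul_mx_diag !mxE.
have de : diag_mx d * diag_mx e = 1.
  rewrite -[diag_mx d]mulr1 conjE; apply/matrixP => i j; rewrite !mxE.
  by case: eqP => [->|_]; rewrite ?mulr0 ?mul0r // mulr1 divff.
have ed : diag_mx e * diag_mx d = 1 by rewrite -mulmxE diag_mxC.
rewrite -conjE; apply: graded_image_conj => // h c /vasilovskyP c0.
by apply/vasilovskyP=> i j /c0 cij; rewrite conjE mxE cij mulr0 mul0r.
Qed.

Lemma graded_image_shift h b : graded_image x f b ->
  graded_image x f (\matrix_(i, j) b (i + h) (j + h)).
Proof.
move=> Sb; pose s := perm (addIr h).
have conjE c :
    perm_mx s * c * perm_mx s^-1%g = \matrix_(i, j) c (i + h) (j + h).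
  by apply/matrixP=> i j; rewrite -!mulmxE -row_permE -col_permE !mxE !permE.
have perm_mxM1 (t t' : 'S_n.+1) :
    (t * t' = 1)%g -> perm_mx t * perm_mx t' = 1 :> 'M[K]_n.+1.
  by move=> tt'; rewrite -mulmxE -perm_mxM tt' perm_mx1.
rewrite -conjE; apply: graded_image_conj => //.
- by rewrite perm_mxM1 ?mulVg.
- by rewrite perm_mxM1 ?mulgV.
move=> k c /vasilovskyP c0; apply/vasilovskyP => i j ne_k.
by rewrite conjE mxE c0 // opprD addrACA subrr addr0.
Qed.

(** On the component of degree [g], conjugation [T] by the diagonal matrix [d]
    below has eigenvalues 2, 1/2 and 1, and 2 is attained at [(j, j + g)] alone;
    a polynomial in [T] thus isolates this entry of [b]. *)
Lemma lin_span_graded_image_delta g j b : [pchar K] =i pred0 ->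
    g != 0 -> homogeneous f g -> graded_image x f b -> b j (j + g) != 0 ->
  lin_span (graded_image x f) (delta_mx j (j + g)).
Proof.
move=> /pcharf0P charK g_neq0 f_homog Sb bj_neq0.
have nat_neq0 k : k.+1%:R != 0 :> K by rewrite charK.
pose d : 'rV[K]_n.+1 := \row_k (if k == j then 2 else 1).
have d_neq0 k : d 0 k != 0 by rewrite mxE; case: ifP; rewrite ?oner_neq0.
pose T b : 'M[K]_n.+1 := \matrix_(k, l) (d 0 k * b k l / d 0 l).
(* The right-hand side is (T - 1)(T - 1/2) b, a polynomial in T that vanishes at
   1 and 1/2 and takes the value 3/2 at 2. *)
have eigen : (3 / 2 * b j (j + g)) *: delta_mx j (j + g)
    = T (T b) + (- (3 / 2)) *: T b + 2^-1 *: b.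
  have /vasilovskyP b0 := graded_image_vasilovsky f_homog Sb.
  apply/matrixP=> k l; rewrite !mxE.
  have [def_g | ne_g] := eqVneq (l - k) g; last first.
    have -> : (k == j) && (l == j + g) = false.
      apply: contraNF ne_g => /andP[/eqP-> /eqP->].
      by rewrite addrC addKr.
    by rewrite (b0 k l) // !(mulr0, mul0r, addr0).
  have {def_g} -> : l = k + g by rewrite -def_g addrC subrK.
  have [-> | ne_k] := eqVneq k j.
    have -> : (j + g == j) = false.
      by rewrite -subr_eq0 addrAC subrr add0r (negPf g_neq0).
    rewrite !eqxx /=.
    by field; rewrite ?nat_neq0 ?oner_neq0.
  have [def_j | _] := eqVneq (k + g) j; rewrite /= mulr0.
    by field; rewrite ?nat_neq0 ?oner_neq0.
  by field; rewrite ?nat_neq0 ?oner_neq0.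
have c_neq0 : 3 / 2 * b j (j + g) != 0.
  by rewrite !mulf_neq0 ?invr_eq0.
rewrite -[delta_mx _ _](scalerK c_neq0) eigen.
have ST c : graded_image x f c -> graded_image x f (T c).
  exact: graded_image_diag.
by apply/lin_spanZ/lin_spanD; first apply/lin_spanD;
  do ?apply/lin_spanZ; apply/lin_span_incl; do ?apply/ST.
Qed.

Lemma graded_image_neq0 : ~ graded_identity x f ->
  exists2 b, graded_image x f b & b != 0.
Proof.
move=> not_id; apply: NNPP => no_b; apply: not_id.
have im0 b : graded_image x f b -> b = 0.
  by move=> Sb; apply: NNPP => /eqP b_neq0; apply: no_b; exists b.
move=> b; split=> [/im0 // | ->].
(* The image is nonempty, as it contains the value of f at (0, ..., 0). *)
pose a := [tuple of nseq m (0 : 'M[K]_n.+1)].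
have Sa : graded_image x f (peval x a f).
  by exists a => // i; rewrite (tnth_nth 0) nth_nseq if_same mem0v.
by rewrite -(im0 _ Sa).
Qed.

End GradedImage.

Theorem lemma3 (K : fieldType) (charK : [pchar K] =i pred0) (n m : nat)
  (x : m.-tuple (variable n)) (uniq_x : uniq x)
  (f : graded_poly K n) (f_in_x : poly_in f x)
  (g : 'I_n.+1) (f_homog : homogeneous f g) (g_neq0 : g != 0) :
  ~ graded_identity x f ->
  forall b : 'M[K]_n.+1,
    lin_span (graded_image x f) b <-> b \in vasilovsky K g.
Proof.
move=> /graded_image_neq0[b0 Sb0 b0_neq0] b; split.
  by apply: lin_span_sub => c; apply: graded_image_vasilovsky.
have /vasilovskyP b0_deg := graded_image_vasilovsky f_homog Sb0.
have [i b0i_neq0] : exists i, b0 i (i + g) != 0.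
  apply/existsP; apply: contraR b0_neq0 => /existsPn b0i0.
  rewrite (vasilovsky_sum_delta b0_deg) big1 // => i _.
  by move/negbNE/eqP: (b0i0 i) => ->; rewrite scale0r.
move=> /vasilovskyP/vasilovsky_sum_delta->.
elim/big_rec: _ => [|j c _ Sc]; first exact: lin_span0.
apply/lin_spanD/Sc/lin_spanZ.
have Sb1 := graded_image_shift (i - j) Sb0.
apply: (lin_span_graded_image_delta _ _ _ Sb1) => //.
by rewrite mxE addrAC [j + _]addrC subrK.
Qed.
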